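(* Let $f\in\Omega_{\mathcal{A}}$ be given by $f(z)=z+\sum_{n=2}^\infty a_nz^n$ for $z\in\mathbb{D}$. Then for $|z|=r$, $$|f(z)|+\sum_{n=2}^\infty|a_n|r^n\leq d\left(f(0),\partial f(\mathbb{D})\right)\quad\text{for}\quad r\leq\frac{\sqrt{3}-1}{2}.$$ The radius $(\sqrt{3}-1)/2$ is the best possible, i.e. it cannot be replaced by any larger number valid for all $f\in\Omega_{\mathcal{A}}$.
   Context: $\mathbb{D}=\{z\in\mathbb{C}:|z|<1\}$. $\mathcal{A}$ is the family of functions $f$ analytic in $\mathbb{D}$ with $f(0)=0$ and $f'(0)=1$. The class $\Omega_{\mathcal{A}}$ consists of all $f(z)=z+\sum_{n=2}^\infty a_nz^n\in\mathcal{A}$ with $\sum_{n=2}^\infty(n-1)|a_n|\leq 1/2$. $d(f(0),\partial f(\mathbb{D}))$ denotes the Euclidean distance between $f(0)$ and the boundary of $f(\mathbb{D})$. *)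

(* Defs.v *)
From Stdlib Require Import Reals.
From Coquelicot Require Import Coquelicot.

Open Scope R_scope.

Definition unit_disk (z : C) : Prop := Cmod z < 1.

(** [u 2 + u 3 + ...] in the extended reals.  [Lim_seq] is the true limit when
    the partial sums are monotone; it is only used for [0 <= u], so that a
    divergent sum is [p_infty] and not a default real value. *)
Definition sum_from2 (u : nat -> R) : Rbar :=
  Lim_seq (sum_n (fun k => u (k + 2)%nat)).

(** Analyticity on the open disk is complex differentiability at each of its
    points; the values of [f] outside the disk are irrelevant. *)
Definition analytic_on_disk (f : C -> C) : Prop :=
  forall z : C, unit_disk z -> ex_derive (K := C_AbsRing) (V := C_NormedModule) f z.

Definition class_A (f : C -> C) : Prop :=
  analytic_on_disk f /\
  f (RtoC 0) = RtoC 0 /\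
  is_derive (K := C_AbsRing) (V := C_NormedModule) f (RtoC 0) (RtoC 1).

(** [f z = z + a 2 * z^2 + a 3 * z^3 + ...] on the disk; [a 0] and [a 1] are
    never used. *)
Definition has_expansion (f : C -> C) (a : nat -> C) : Prop :=
  forall z : C, unit_disk z ->
    is_series (K := C_AbsRing) (V := C_NormedModule)
      (fun k => (a (k + 2)%nat * z ^ (k + 2))%C) (f z - z)%C.

Definition Omega_A (f : C -> C) : Prop :=
  class_A f /\
  exists a : nat -> C,
    has_expansion f a /\
    Rbar_le (sum_from2 (fun n => (INR n - 1) * Cmod (a n))) (Finite (1 / 2)).

Definition image_disk (f : C -> C) (w : C) : Prop :=
  exists z : C, unit_disk z /\ f z = w.

Definition boundary (S : C -> Prop) (w : C) : Prop :=
  forall eps : posreal,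
    (exists y : C, Cmod (y - w)%C < eps /\ S y) /\
    (exists y : C, Cmod (y - w)%C < eps /\ ~ S y).

(** Extended-real infimum: the distance to the empty set is [p_infty]. *)
Definition dist_to_set (p : C) (S : C -> Prop) : Rbar :=
  Glb_Rbar (fun d => exists w : C, S w /\ d = Cmod (w - p)%C).

(** The inequality [|f z| + sum_(n >= 2) |a_n| r^n <= d (f 0, boundary of f(D))]
    for all [f] in the class and all [z] in the disk with [|z| = r <= rho]. *)
Definition bohr_valid (rho : R) : Prop :=
  forall (f : C -> C) (a : nat -> C),
    Omega_A f -> has_expansion f a ->
    forall (z : C) (r : R), unit_disk z -> Cmod z = r -> r <= rho ->
      Rbar_le
        (Rbar_plus (Finite (Cmod (f z))) (sum_from2 (fun n => Cmod (a n) * r ^ n)))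
        (dist_to_set (f (RtoC 0)) (boundary (image_disk f))).

(* Main.v *)
Require Import Defs.
From Stdlib Require Import Reals Lra Lia Classical.
From Coquelicot Require Import Coquelicot.

Open Scope R_scope.

(** Put [g z = f z - z]. Since [n <= 2 (n - 1)] for [n >= 2], the coefficient bound gives
    [|g z| <= r^2 / 2] for [|z| <= r], and makes [g] [r]-Lipschitz on that disk. Hence
    [|f z| + sum |a_n| r^n <= r + r^2], which is at most [1/2] for [r <= (sqrt 3 - 1) / 2].
    If [|w| < 1/2], then [|w| <= r - r^2 / 2] for some [r < 1], so [z |-> w - g z] is a
    contraction of [|z| <= r] and [f z = w] has a solution: [f] covers the disk of
    radius [1/2]. For sharpness take [z + z^2 / 2], which omits the value [-1/2] that it
    approaches at [-1]. As [has_expansion] does not mention the coefficients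
    that witness [Omega_A], uniqueness of coefficients is needed as well. *)

(** * Limits, sums and series estimates for complex sequences *)

Lemma filterlim_Cmod (u : nat -> C) (l : C) :
  filterlim u eventually (locally (T := C_NormedModule) l) <->
  is_lim_seq (fun n => Cmod (u n - l)%C) 0.
Proof.
  split; intros H.
  - apply is_lim_seq_spec; intros eps.
    destruct (proj1 (filterlim_locally_ball_norm (U := C_NormedModule) u l) H eps)
      as [N HN].
    exists N; intros n Hn.
    rewrite Rminus_0_r, Rabs_pos_eq by apply Cmod_ge_0.
    exact (HN n Hn).
  - apply (filterlim_locally_ball_norm (U := C_NormedModule) u l); intros eps.
    apply is_lim_seq_spec in H; destruct (H eps) as [N HN].
    exists N; intros n Hn.
    specialize (HN n Hn).
    rewrite Rminus_0_r, Rabs_pos_eq in HN by apply Cmod_ge_0.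
    exact HN.
Qed.

(** Nonnegative terms make the partial sums increase, so each of them stays below their limit, and
    hence below [M]. *)
Lemma sum_n_le_of_sum_from2 (u : nat -> R) (M : R) :
  (forall n, 0 <= u (n + 2)%nat) -> Rbar_le (sum_from2 u) M ->
  forall N, sum_n (fun k => u (k + 2)%nat) N <= M.
Proof.
  intros Hu HM N.
  apply (Rbar_le_trans (Finite _) (sum_from2 u) (Finite M)); [|exact HM].
  rewrite <- (Lim_seq_const (sum_n (fun k => u (k + 2)%nat) N)).
  apply Lim_seq_le_loc; exists N; intros n Hn.
  induction Hn as [|n Hn IH]; [apply Rle_refl|].
  rewrite sum_Sn; unfold plus; simpl.
  specialize (Hu (S n)); simpl in Hu; lra.
Qed.

Lemma sum_from2_le_of_sum_n (u : nat -> R) (M : R) :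
  (forall N, sum_n (fun k => u (k + 2)%nat) N <= M) -> Rbar_le (sum_from2 u) M.
Proof.
  intros H; rewrite <- (Lim_seq_const M).
  apply Lim_seq_le_loc; exists 0%nat; intros n _; apply H.
Qed.

Lemma Cmod_is_series_le (u : nat -> C) (l : C) (M : R) :
  is_series (K := C_AbsRing) (V := C_NormedModule) u l ->
  (forall N, sum_n (fun k => Cmod (u k)) N <= M) -> Cmod l <= M.
Proof.
  intros Hl HM.
  apply (is_lim_seq_le (fun n => Cmod (sum_n u n)) (fun _ => M) (Cmod l) M).
  - intros n; eapply Rle_trans; [|apply (HM n)].
    exact (norm_sum_n_m (K := C_AbsRing) (V := C_NormedModule) u 0 n).
  - exact (filterlim_comp _ _ _ _ _ _ _ _ Hl
             (filterlim_norm (K := C_AbsRing) (V := C_NormedModule) l)).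
  - apply is_lim_seq_const.
Qed.

(** Applied with [w] the weighted coefficients and [S = 1/2]: a bound on the error [f z - z], or on
    a difference of two errors, reduces to a termwise comparison with a common factor [c]. *)
Lemma Cmod_series_dominated (u : nat -> C) (l : C) (w : nat -> R) (S c : R) :
  is_series (K := C_AbsRing) (V := C_NormedModule) u l ->
  (forall N, sum_n w N <= S) -> 0 <= c ->
  (forall k, Cmod (u k) <= c * w k) -> Cmod l <= c * S.
Proof.
  intros Hl Hw Hc Hu; apply (Cmod_is_series_le u); [exact Hl|]; intros N.
  apply Rle_trans with (sum_n (fun k => c * w k) N).
  - apply sum_n_m_le; exact Hu.
  - apply Rle_trans with (c * sum_n w N); [|apply Rmult_le_compat_l; auto].
    right; exact (sum_n_mult_l (K := R_Ring) c w N).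
Qed.

(** * Estimates for powers and coefficients *)

Lemma Cmod_pow_sub_le (z w : C) (r : R) (n : nat) :
  Cmod z <= r -> Cmod w <= r ->
  Cmod (z ^ S n - w ^ S n)%C <= INR (S n) * r ^ n * Cmod (z - w)%C.
Proof.
  intros Hz Hw.
  assert (Hr : 0 <= r) by (eapply Rle_trans; [apply Cmod_ge_0|exact Hz]).
  induction n as [|n IH].
  - simpl. replace (z * 1 - w * 1)%C with (z - w)%C by ring. lra.
  (* Splitting off one factor exposes the previous difference of powers; the remaining term
     contributes the extra [r ^ S n * Cmod (z - w)]. *)
  - replace (z ^ S (S n) - w ^ S (S n))%C
      with (z * (z ^ S n - w ^ S n) + w ^ S n * (z - w))%C by (simpl; ring).
    eapply Rle_trans; [apply Cmod_triangle|].
    rewrite !Cmod_mult, Cmod_pow, (S_INR (S n)).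
    assert (H1 : Cmod w ^ S n <= r ^ S n)
      by (apply pow_incr; split; [apply Cmod_ge_0|exact Hw]).
    assert (H2 : Cmod z * Cmod (z ^ S n - w ^ S n)%C
                 <= r * (INR (S n) * r ^ n * Cmod (z - w)%C))
      by (apply Rmult_le_compat; try apply Cmod_ge_0; assumption).
    assert (H3 : Cmod w ^ S n * Cmod (z - w)%C <= r ^ S n * Cmod (z - w)%C)
      by (apply Rmult_le_compat_r; [apply Cmod_ge_0|exact H1]).
    replace ((INR (S n) + 1) * r ^ S n * Cmod (z - w)%C) with
      (r * (INR (S n) * r ^ n * Cmod (z - w)%C) + r ^ S n * Cmod (z - w)%C)
      by (simpl; ring).
    lra.
Qed.

Lemma pow_le_sq (r : R) (k : nat) : 0 <= r <= 1 -> r ^ (k + 2) <= r ^ 2.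
Proof.
  intros [H0 H1]; rewrite pow_add.
  rewrite <- (Rmult_1_l (r ^ 2)) at 2.
  apply Rmult_le_compat_r; [apply pow_le; exact H0|].
  rewrite <- (pow1 k); apply pow_incr; auto.
Qed.

(** The index is shifted: [k] stands for [n = k + 2], so the weight [n - 1] becomes [INR k + 1]. *)
Definition weighted_coeff (a : nat -> C) (k : nat) : R :=
  (INR k + 1) * Cmod (a (k + 2)%nat).

(** The weight is at least 1, and [r ^ n <= r ^ 2] for [n >= 2]. Summation will bound both the error
    and the Bohr sum by [r ^ 2 / 2]. *)
Lemma coeff_pow_le (a : nat -> C) (r : R) (k : nat) : 0 <= r <= 1 ->
  Cmod (a (k + 2)%nat) * r ^ (k + 2) <= r ^ 2 * weighted_coeff a k.
Proof.
  intros Hr; unfold weighted_coeff.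
  pose proof (pow_le_sq r k Hr) as H.
  pose proof (Cmod_ge_0 (a (k + 2)%nat)) as Ha.
  assert (H2 : 0 <= r ^ 2) by (apply pow_le; lra).
  assert (Hk : 0 <= INR k * (Cmod (a (k + 2)%nat) * r ^ 2))
    by (apply Rmult_le_pos; [apply pos_INR|apply Rmult_le_pos; auto]).
  pose proof (Rmult_le_compat_l _ _ _ Ha H) as H3; lra.
Qed.

(** * Growth and Lipschitz bounds, and covering of the half disk *)

Section OmegaFunction.

Variables (f : C -> C) (a : nat -> C).
Hypothesis f_exp : has_expansion f a.
Hypothesis a_sum : forall N, sum_n (weighted_coeff a) N <= 1 / 2.

Lemma expansion_error_le (z : C) : unit_disk z -> Cmod (f z - z)%C <= Cmod z ^ 2 / 2.
Proof.
  intros Hz; replace (Cmod z ^ 2 / 2) with (Cmod z ^ 2 * (1 / 2)) by field.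
  apply (Cmod_series_dominated _ _ (weighted_coeff a) _ _ (f_exp z Hz) a_sum).
  - apply pow_le, Cmod_ge_0.
  - intros k; rewrite Cmod_mult, Cmod_pow; apply coeff_pow_le.
    unfold unit_disk in Hz; pose proof (Cmod_ge_0 z); lra.
Qed.

(** The [n]-th power has Lipschitz constant [n r^(n-1) <= 2 (n-1) r] on the disk of radius [r], and
    the factor 2 cancels against the coefficient sum [1/2]. *)
Lemma expansion_error_Lipschitz (r : R) (z w : C) : r < 1 ->
  Cmod z <= r -> Cmod w <= r ->
  Cmod ((f z - z) - (f w - w))%C <= r * Cmod (z - w)%C.
Proof.
  intros Hr Hz Hw.
  assert (Hr0 : 0 <= r) by (eapply Rle_trans; [apply Cmod_ge_0|exact Hz]).
  assert (Dz : unit_disk z) by (unfold unit_disk; lra).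
  assert (Dw : unit_disk w) by (unfold unit_disk; lra).
  replace (r * Cmod (z - w)%C) with (2 * r * Cmod (z - w)%C * (1 / 2)) by field.
  apply (Cmod_series_dominated _ _ (weighted_coeff a) _ _
           (is_series_minus _ _ _ _ (f_exp z Dz) (f_exp w Dw)) a_sum).
  - repeat apply Rmult_le_pos; try apply Cmod_ge_0; lra.
  - intros k.
    change (Cmod (a (k + 2)%nat * z ^ (k + 2) - a (k + 2)%nat * w ^ (k + 2))%C
            <= 2 * r * Cmod (z - w)%C * weighted_coeff a k).
    replace (a (k + 2)%nat * z ^ (k + 2) - a (k + 2)%nat * w ^ (k + 2))%C
      with (a (k + 2)%nat * (z ^ (k + 2) - w ^ (k + 2)))%C by ring.
    rewrite Cmod_mult; unfold weighted_coeff.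
    assert (H : Cmod (z ^ (k + 2) - w ^ (k + 2))%C
                <= 2 * (INR k + 1) * (r * Cmod (z - w)%C)).
    { replace (k + 2)%nat with (S (S k)) by lia.
      eapply Rle_trans; [apply Cmod_pow_sub_le; eassumption|].
      rewrite <- Rmult_assoc.
      apply Rmult_le_compat_r; [apply Cmod_ge_0|].
      apply Rmult_le_compat; [apply pos_INR|apply pow_le; lra| |].
      - rewrite !S_INR; pose proof (pos_INR k); lra.
      - simpl; rewrite <- (Rmult_1_r r) at 3.
        apply Rmult_le_compat_l; [lra|].
        rewrite <- (pow1 k); apply pow_incr; lra. }
    pose proof (Rmult_le_compat_l _ _ _ (Cmod_ge_0 (a (k + 2)%nat)) H); lra.
Qed.

(* The Picard iteration for the fixed point [z = w - (f z - z)], that is, [f z = w]. *)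
Fixpoint preimage_iter (w : C) (n : nat) : C :=
  match n with
  | O => RtoC 0
  | S m => (w - (f (preimage_iter w m) - preimage_iter w m))%C
  end.

(** The condition on [w] and [r] says that the iterated map sends the closed disk of radius [r] into
    itself, its error term being at most [r ^ 2 / 2] there. *)
Lemma preimage_iter_bound (w : C) (r : R) : 0 <= r < 1 -> Cmod w + r ^ 2 / 2 <= r ->
  forall n, Cmod (preimage_iter w n) <= r.
Proof.
  intros Hr Hw; induction n as [|n IH]; simpl preimage_iter.
  - rewrite Cmod_0; lra.
  - unfold Cminus at 1.
    eapply Rle_trans; [apply Cmod_triangle|]; rewrite Cmod_opp.
    assert (D : unit_disk (preimage_iter w n)) by (unfold unit_disk; lra).
    pose proof (expansion_error_le _ D) as H.
    assert (Cmod (preimage_iter w n) ^ 2 <= r ^ 2)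
      by (apply pow_incr; split; [apply Cmod_ge_0|exact IH]).
    lra.
Qed.

Lemma preimage_iter_step (w : C) (r : R) : 0 <= r < 1 -> Cmod w + r ^ 2 / 2 <= r ->
  forall n, Cmod (preimage_iter w (S n) - preimage_iter w n)%C
            <= Cmod (preimage_iter w 1) * r ^ n.
Proof.
  intros Hr Hw; pose proof (preimage_iter_bound w r Hr Hw) as B.
  induction n as [|n IH].
  - change (preimage_iter w 0) with (RtoC 0).
    replace (preimage_iter w 1 - RtoC 0)%C with (preimage_iter w 1) by ring.
    simpl pow; lra.
  - replace (preimage_iter w (S (S n)) - preimage_iter w (S n))%C with
      (- ((f (preimage_iter w (S n)) - preimage_iter w (S n))
          - (f (preimage_iter w n) - preimage_iter w n)))%C
      by (simpl preimage_iter; ring).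
    rewrite Cmod_opp.
    eapply Rle_trans;
      [apply (expansion_error_Lipschitz r); [lra|apply B|apply B]|].
    replace (Cmod (preimage_iter w 1) * r ^ S n)
      with (r * (Cmod (preimage_iter w 1) * r ^ n)) by (simpl; ring).
    apply Rmult_le_compat_l; [lra|exact IH].
Qed.

(** The increments are dominated by a geometric series, so completeness of the complex plane makes
    them summable; their partial sums telescope to the iterates, shifted by one. *)
Lemma preimage_iter_converges (w : C) (r : R) : 0 <= r < 1 ->
  Cmod w + r ^ 2 / 2 <= r ->
  exists z, is_lim_seq (fun n => Cmod (preimage_iter w n - z)%C) 0.
Proof.
  intros Hr Hw.
  destruct (ex_series_le (K := C_AbsRing) (V := C_CompleteNormedModule)
    (fun n => preimage_iter w (S n) - preimage_iter w n)%C
    (fun n => Cmod (preimage_iter w 1) * r ^ n)) as [z Hz].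
  - exact (preimage_iter_step w r Hr Hw).
  - apply (ex_series_scal (K := R_AbsRing) (V := R_NormedModule)
             (Cmod (preimage_iter w 1)) (fun n => r ^ n)), ex_series_geom.
    rewrite Rabs_pos_eq; lra.
  - exists z; apply is_lim_seq_incr_1.
    apply filterlim_Cmod in Hz.
    eapply is_lim_seq_ext; [|exact Hz]; intros n.
    apply (f_equal (fun y => Cmod (y - z)%C)).
    induction n as [|n IH].
    + rewrite sum_O; simpl preimage_iter; ring.
    + rewrite sum_Sn, IH.
      change (preimage_iter w (S n) + (preimage_iter w (S (S n)) - preimage_iter w (S n))
              = preimage_iter w (S (S n)))%C; ring.
Qed.

Lemma half_disk_in_image (w : C) : Cmod w < 1 / 2 -> image_disk f w.
Proof.
  intros Hw; pose proof (Cmod_ge_0 w) as Hw0.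
  assert (Hr : exists r, 0 <= r < 1 /\ Cmod w + r ^ 2 / 2 <= r).
  (* With this choice [r - Cmod w = 1/2], so the requirement becomes [r ^ 2 <= 1]. *)
  { exists (1/2 + Cmod w); split; [lra|]; nra. }
  destruct Hr as [r [Hr Hwr]].
  pose proof (preimage_iter_bound w r Hr Hwr) as B.
  destruct (preimage_iter_converges w r Hr Hwr) as [z Hz].
  (* The closed disk contains the limit of the iterates, so the Lipschitz bound is available at [z]
     too. *)
  assert (Bz : Cmod z <= r).
  { apply (is_lim_seq_le (fun _ => Cmod z)
             (fun n => r + Cmod (preimage_iter w n - z)%C) (Cmod z) r).
    - intros n.
      replace z with (preimage_iter w n + - (preimage_iter w n - z))%C at 1 by ring.
      eapply Rle_trans; [apply Cmod_triangle|].
      rewrite Cmod_opp; specialize (B n); lra.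
    - apply is_lim_seq_const.
    - replace (Finite r) with (Finite (r + 0)) by (f_equal; ring).
      apply is_lim_seq_plus'; [apply is_lim_seq_const|exact Hz]. }
  exists z; split; [unfold unit_disk; lra|].
  (* The recursion rewrites [f z - w] as an error difference between [z] and the [n]-th iterate plus
     the distance term for the next iterate; both tend to 0. *)
  assert (E : Cmod (f z - w)%C <= 0).
  { apply (is_lim_seq_le (fun _ => Cmod (f z - w)%C)
      (fun n => r * Cmod (preimage_iter w n - z)%C + Cmod (preimage_iter w (S n) - z)%C)
      (Cmod (f z - w)%C) 0).
    - intros n.
      replace (f z - w)%C with
        (- ((f (preimage_iter w n) - preimage_iter w n) - (f z - z))
         + - (preimage_iter w (S n) - z))%C by (simpl; ring).
      eapply Rle_trans; [apply Cmod_triangle|]; rewrite !Cmod_opp.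
      apply Rplus_le_compat_r, expansion_error_Lipschitz; [lra|apply B|exact Bz].
    - apply is_lim_seq_const.
    - replace (Finite 0) with (Finite (r * 0 + 0)) by (f_equal; ring).
      apply is_lim_seq_plus'; [|apply is_lim_seq_incr_1 in Hz; exact Hz].
      exact (is_lim_seq_scal_l _ r _ Hz). }
  assert (E0 : (f z - w)%C = RtoC 0)
    by (apply Cmod_eq_0; pose proof (Cmod_ge_0 (f z - w)%C); lra).
  replace (f z) with (f z - w + w)%C by ring; rewrite E0; ring.
Qed.

(** A boundary point of modulus below [1/2] would have a whole neighbourhood inside the covered
    disk, yet points outside the image lie arbitrarily close to it. *)
Lemma dist_boundary_ge_half :
  Rbar_le (1 / 2) (dist_to_set (RtoC 0) (boundary (image_disk f))).
Proof.
  unfold dist_to_set; apply Glb_Rbar_correct; intros d [w [Hw ->]].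
  replace (w - RtoC 0)%C with w by ring.
  simpl; apply Rnot_lt_le; intros Hlt.
  assert (Heps : 0 < 1 / 2 - Cmod w) by lra.
  destruct (Hw (mkposreal _ Heps)) as [_ [y [Hy Hny]]]; simpl in Hy.
  apply Hny, half_disk_in_image.
  replace y with (w + (y - w))%C by ring.
  pose proof (Cmod_triangle w (y - w)%C); lra.
Qed.

End OmegaFunction.

(** * Uniqueness of power series coefficients *)

Lemma CV_radius_gt_0_of_series (b : nat -> R) (x : R) : x <> 0 ->
  ex_series (fun n => b n * x ^ n) -> Rbar_lt 0 (CV_radius b).
Proof.
  intros Hx Hs; apply Rbar_not_le_lt; intros Hle.
  apply (CV_disk_outside b x).
  - eapply Rbar_le_lt_trans; [exact Hle|]; simpl; apply Rabs_pos_lt, Hx.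
  - exact (ex_series_lim_0 _ Hs).
Qed.

Lemma real_coeff_zero (c : nat -> R) :
  (forall x, Rabs x < 1 -> is_series (fun k => c k * x ^ (k + 2)) 0) ->
  forall k, c k = 0.
Proof.
  intros H k.
  (* Two leading zeros turn the shifted series into an ordinary power series, to which the real
     identity theorem applies. *)
  set (b := fun n => match n with S (S m) => c m | _ => 0 end).
  assert (Hb : forall x, Rabs x < 1 -> is_series (fun n => b n * x ^ n) 0).
  { intros x Hx; apply (is_series_decr_n _ 2); [lia|].
    match goal with |- is_series _ ?l => replace l with 0 end.
    - eapply is_series_ext; [|exact (H x Hx)].
      intros n; cbv beta; replace (n + 2)%nat with (2 + n)%nat by lia; reflexivity.
    - simpl Init.Nat.pred; rewrite sum_Sn, sum_O; unfold plus, opp; simpl; ring. }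
  change (c k) with (b (S (S k))).
  apply (PSeries_ext_recip b (fun _ => 0) (S (S k))).
  - apply (CV_radius_gt_0_of_series b (1/2)); [lra|].
    exists 0; apply Hb; rewrite Rabs_pos_eq; lra.
  - rewrite CV_radius_const_0; exact I.
  - exists (mkposreal 1 Rlt_0_1); intros x Hx.
    rewrite PSeries_const_0; apply is_series_unique, Hb.
    unfold ball in Hx; simpl in Hx; unfold AbsRing_ball, abs, minus, plus, opp in Hx.
    simpl in Hx; rewrite Ropp_0, Rplus_0_r in Hx; exact Hx.
Qed.

(** Meant for the real and imaginary parts: additivity carries [h] through the partial sums, and the
    bound by [Cmod] through the limit. *)
Lemma is_series_real_additive (h : C -> R) (u : nat -> C) (l : C) :
  (forall x y, h (x + y)%C = h x + h y) -> (forall x, Rabs (h x) <= Cmod x) ->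
  is_series (K := C_AbsRing) (V := C_NormedModule) u l ->
  is_series (fun n => h (u n)) (h l).
Proof.
  intros Hadd Hle H; apply filterlim_Cmod in H.
  assert (Hsub : forall x y, h (x - y)%C = h x - h y).
  { intros x y; replace x with (x - y + y)%C at 2 by ring; rewrite (Hadd (x - y)%C y); ring. }
  assert (E : forall n, sum_n (fun k => h (u k)) n
                        = h (sum_n (G := C_NormedModule) u n)).
  { induction n as [|n IH]; [now rewrite !sum_O|].
    rewrite !sum_Sn, IH; symmetry; apply Hadd. }
  change (is_lim_seq (sum_n (fun n => h (u n))) (h l)).
  replace (Finite (h l)) with (Finite (0 + h l)) by (f_equal; ring).
  apply (is_lim_seq_ext (fun n => h (sum_n (G := C_NormedModule) u n - l)%C + h l)).
  - intros n; rewrite E, Hsub; ring.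
  - apply is_lim_seq_plus'; [|apply is_lim_seq_const].
    apply is_lim_seq_abs_0.
    apply (is_lim_seq_le_le (fun _ => 0) _ (fun n => Cmod (sum_n u n - l)%C)).
    + intros n; split; [apply Rabs_pos|apply Hle].
    + apply is_lim_seq_const.
    + exact H.
Qed.

(** On the real interval [(-1, 1)] the powers of [z] are real, so the real and imaginary parts of
    the series are real power series with sum 0. *)
Lemma complex_coeff_zero (c : nat -> C) :
  (forall z, unit_disk z -> is_series (K := C_AbsRing) (V := C_NormedModule)
     (fun k => c k * z ^ (k + 2))%C (RtoC 0)) ->
  forall k, c k = RtoC 0.
Proof.
  intros H.
  assert (P : forall h : C -> R,
    (forall x y, h (x + y)%C = h x + h y) -> (forall x, Rabs (h x) <= Cmod x) ->
    (forall x r, h (x * RtoC r)%C = h x * r) -> h (RtoC 0) = 0 ->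
    forall k, h (c k) = 0).
  { intros h Hadd Hle Hmul H0; apply real_coeff_zero; intros x Hx.
    rewrite <- H0.
    apply is_series_ext with (fun k => h (c k * RtoC x ^ (k + 2))%C).
    - intros n; rewrite <- RtoC_pow; apply Hmul.
    - apply is_series_real_additive; auto.
      apply H; unfold unit_disk; now rewrite Cmod_R. }
  intros k; apply injective_projections.
  - apply (P Re); try reflexivity; [apply re_le_Cmod|intros; apply re_scal_r].
  - apply (P Im); try reflexivity; [|intros; apply im_scal_r].
    intros x; eapply Rle_trans; [apply Rmax_r|apply Rmax_Cmod].
Qed.

Lemma expansion_unique (f : C -> C) (a b : nat -> C) :
  has_expansion f a -> has_expansion f b ->
  forall k, a (k + 2)%nat = b (k + 2)%nat.
Proof.
  intros Ha Hb k.
  assert (E : (a (k + 2)%nat - b (k + 2)%nat)%C = RtoC 0).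
  { apply (complex_coeff_zero (fun k => a (k + 2)%nat - b (k + 2)%nat)%C).
    intros z Hz.
    pose proof (is_series_minus _ _ _ _ (Ha z Hz) (Hb z Hz)) as H.
    replace (RtoC 0) with (plus (G := C_NormedModule) (f z - z)%C (opp (f z - z)%C))
      by (apply (plus_opp_r (G := C_AbelianGroup))).
    eapply is_series_ext; [|exact H]; intros n.
    change (plus (G := C_NormedModule)) with Cplus.
    change (opp (G := C_NormedModule)) with Copp. simpl. ring. }
  replace (a (k + 2)%nat) with (a (k + 2)%nat - b (k + 2)%nat + b (k + 2)%nat)%C by ring.
  rewrite E; ring.
Qed.

Lemma Omega_coeff_sum (f : C -> C) (a : nat -> C) :
  Omega_A f -> has_expansion f a -> forall N, sum_n (weighted_coeff a) N <= 1 / 2.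
Proof.
  intros [_ [b [Hb Hsum]]] Ha N.
  rewrite (sum_n_ext _ (fun k => (INR (k + 2) - 1) * Cmod (b (k + 2)%nat))).
  - apply (sum_n_le_of_sum_from2 (fun n => (INR n - 1) * Cmod (b n))); [|exact Hsum].
    intros n; apply Rmult_le_pos; [|apply Cmod_ge_0].
    rewrite plus_INR; simpl; pose proof (pos_INR n); lra.
  - intros k; unfold weighted_coeff; rewrite (expansion_unique f a b Ha Hb k), plus_INR.
    simpl; ring.
Qed.

(** * The Bohr inequality up to the radius *)

Lemma bohr_radius_root : let r := (sqrt 3 - 1) / 2 in 0 < r < 1 /\ r + r ^ 2 = 1 / 2.
Proof.
  pose proof (sqrt_sqrt 3 ltac:(lra)); pose proof (sqrt_pos 3).
  simpl; split; [split; nra|]; nra.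
Qed.

Lemma bohr_valid_radius : bohr_valid ((sqrt 3 - 1) / 2).
Proof.
  intros f a Hf Ha z r Hz Hzr Hr.
  pose proof (Omega_coeff_sum f a Hf Ha) as Hsum.
  destruct Hf as [[_ [Hf0 _]] _]; rewrite Hf0.
  eapply Rbar_le_trans; [|apply (dist_boundary_ge_half f a Ha Hsum)].
  destruct bohr_radius_root as [Hrho Hroot].
  assert (Hr0 : 0 <= r) by (rewrite <- Hzr; apply Cmod_ge_0).
  assert (Hfz : Cmod (f z) <= r + r ^ 2 / 2).
  { replace (f z) with (z + (f z - z))%C by ring.
    eapply Rle_trans; [apply Cmod_triangle|].
    pose proof (expansion_error_le f a Ha Hsum z Hz) as H; rewrite Hzr in *; lra. }
  assert (Hs : Rbar_le (sum_from2 (fun n => Cmod (a n) * r ^ n)) (r ^ 2 * (1 / 2))).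
  { apply sum_from2_le_of_sum_n; intros N.
    apply Rle_trans with (sum_n (fun k => r ^ 2 * weighted_coeff a k) N).
    - apply sum_n_m_le; intros k; apply coeff_pow_le; lra.
    - apply Rle_trans with (r ^ 2 * sum_n (weighted_coeff a) N);
        [right; exact (sum_n_mult_l (K := R_Ring) _ _ N)|].
      apply Rmult_le_compat_l; [apply pow_le; exact Hr0|apply Hsum]. }
  (* The error and the Bohr sum each contribute [r ^ 2 / 2]; the total [r + r ^ 2] increases with
     [r] and equals [1/2] at the radius. *)
  apply Rbar_le_trans with (Rbar_plus (r + r ^ 2 / 2) (r ^ 2 * (1 / 2))).
  - apply Rbar_plus_le_compat; [exact Hfz|exact Hs].
  - assert (r ^ 2 <= ((sqrt 3 - 1) / 2) ^ 2) by (apply pow_incr; split; assumption).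
    simpl Rbar_plus; simpl Rbar_le; lra.
Qed.

(** * The extremal function and sharpness *)

Definition extremal (z : C) : C := (z + RtoC (1 / 2) * (z * z))%C.

(** The single nonzero coefficient exhausts the allowed sum: [(2 - 1) * (1/2) = 1/2]. *)
Definition extremal_coeff (n : nat) : C :=
  match n with 2%nat => RtoC (1 / 2) | _ => RtoC 0 end.

Lemma sum_n_head {G : AbelianMonoid} (u : nat -> G) :
  (forall k, u (S k) = zero) -> forall n, sum_n u n = u 0%nat.
Proof.
  intros H; induction n as [|n IH]; [apply sum_O|].
  rewrite sum_Sn, IH, H; apply plus_zero_r.
Qed.

Lemma sum_from2_head (u : nat -> R) :
  (forall k, u (S k + 2)%nat = 0) -> sum_from2 u = u 2%nat.
Proof.
  intros H; unfold sum_from2; rewrite <- (Lim_seq_const (u 2%nat)).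
  apply Lim_seq_ext; intros n.
  exact (sum_n_head (fun k => u (k + 2)%nat) H n).
Qed.

Lemma extremal_expansion : has_expansion extremal extremal_coeff.
Proof.
  intros z _.
  apply (filterlim_ext (fun _ => extremal z - z)%C); [|apply filterlim_const].
  intros n; rewrite sum_n_head; [unfold extremal; simpl; ring|].
  intros k; simpl; replace (k + 2)%nat with (S (S k)) by lia.
  change (@zero C_NormedModule) with (RtoC 0); simpl; ring.
Qed.

Lemma extremal_derive (z : C) :
  is_derive (K := C_AbsRing) (V := C_NormedModule) extremal z (RtoC 1 + z)%C.
Proof.
  pose proof (is_derive_id (K := C_AbsRing) z) as Hid.
  pose proof (is_derive_mult (K := C_AbsRing) _ _ z _ _ Hid Hid Cmult_comm) as Hsq.
  pose proof (is_derive_mult (K := C_AbsRing) _ _ z _ _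
    (is_derive_const (K := C_AbsRing) (V := AbsRing_NormedModule C_AbsRing)
       (RtoC (1 / 2)) z) Hsq Cmult_comm) as Hhalf.
  pose proof (is_derive_plus (K := C_AbsRing) (V := AbsRing_NormedModule C_AbsRing)
    _ _ z _ _ Hid Hhalf) as H.
  assert (E : (RtoC 1 + (RtoC 0 * (z * z)
                + RtoC (1 / 2) * (RtoC 1 * z + z * RtoC 1)) = RtoC 1 + z)%C)
    by (rewrite RtoC_div by lra; field; apply RtoC_neq; lra).
  (* [C_NormedModule] and [AbsRing_NormedModule C_AbsRing] have different uniform
     structures but the same norm, and [is_domin] only sees the norm. *)
  rewrite <- E; destruct H as [_ Hd]; split; [apply is_linear_scal_l|].
  intros x Hx eps; exact (Hd x Hx eps).
Qed.

Lemma extremal_Omega : Omega_A extremal.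
Proof.
  split; [split; [|split]|].
  - intros z _; eexists; apply extremal_derive.
  - unfold extremal; ring.
  - replace (RtoC 1) with (RtoC 1 + RtoC 0)%C by ring; apply extremal_derive.
  - exists extremal_coeff; split; [apply extremal_expansion|].
    rewrite sum_from2_head.
    + simpl; rewrite Cmod_R, Rabs_pos_eq; lra.
    + intros k; replace (S k + 2)%nat with (S (S (S k))) by lia.
      simpl extremal_coeff; rewrite Cmod_0; ring.
Qed.

(** Completing the square gives [extremal z + 1/2 = (z + 1)^2 / 2], which vanishes only at [z = -1],
    outside the open disk. *)
Lemma extremal_boundary : boundary (image_disk extremal) (RtoC (- (1 / 2))).
Proof.
  intros eps; split.
  (* The point [t - 1] lies in the disk, and its image is at distance [t^2 / 2 < t <= eps] from
     [-1/2]. *)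
  - set (t := Rmin (1 / 2) eps).
    assert (Ht : 0 < t <= 1 / 2)
      by (split; [apply Rmin_glb_lt; [lra|apply cond_pos]|apply Rmin_l]).
    assert (Hte : t <= eps) by apply Rmin_r.
    exists (extremal (RtoC (t - 1))); split.
    + replace (extremal (RtoC (t - 1)) - RtoC (- (1 / 2)))%C with (RtoC (t * t / 2)).
      * rewrite Cmod_R, Rabs_pos_eq; nra.
      * unfold extremal; rewrite <- RtoC_mult, <- RtoC_mult, <- RtoC_plus, <- RtoC_minus.
        f_equal; field.
    + exists (RtoC (t - 1)); split; [|reflexivity].
      unfold unit_disk; rewrite Cmod_R; apply Rabs_def1; lra.
  (* The omitted value itself serves as the nearby point outside the image. *)
  - exists (RtoC (- (1 / 2))); split.
    + replace (RtoC (- (1 / 2)) - RtoC (- (1 / 2)))%C with (RtoC 0) by ring.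
      rewrite Cmod_0; apply cond_pos.
    + intros [z [Hz E]].
      assert (E2 : ((z + RtoC 1) * (z + RtoC 1))%C = RtoC 0).
      { replace ((z + RtoC 1) * (z + RtoC 1))%C
          with (RtoC 2 * extremal z + RtoC 1)%C.
        - rewrite E, <- RtoC_mult, <- RtoC_plus; f_equal; field.
        - unfold extremal; rewrite RtoC_div by lra; field; apply RtoC_inj; lra. }
      assert (E1 : (z + RtoC 1)%C = RtoC 0).
      { destruct (classic ((z + RtoC 1)%C = RtoC 0)) as [h|h]; [exact h|].
        exfalso; exact (Cmult_neq_0 _ _ h h E2). }
      assert (Ez : z = RtoC (- 1))
        by (replace z with (z + RtoC 1 - RtoC 1)%C by ring; rewrite E1;
            rewrite <- RtoC_minus; f_equal; ring).
      unfold unit_disk in Hz; rewrite Ez, Cmod_R, Rabs_left in Hz; lra.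
Qed.

(** At a positive real point [r] the triangle inequality is an equality for the extremal function,
    so the left side is exactly [r + r ^ 2], above [1/2] beyond the root. *)
Lemma bohr_radius_sharp (rho : R) : (sqrt 3 - 1) / 2 < rho -> ~ bohr_valid rho.
Proof.
  intros Hrho Hv.
  destruct bohr_radius_root as [Hr Hroot]; set (r0 := (sqrt 3 - 1) / 2) in *.
  (* The minimum with 1 keeps the test point inside the disk even when [rho] exceeds 1. *)
  set (r := (r0 + Rmin rho 1) / 2).
  assert (r0 < Rmin rho 1) by (apply Rmin_glb_lt; lra).
  pose proof (Rmin_l rho 1); pose proof (Rmin_r rho 1).
  assert (Hr1 : r0 < r < 1 /\ r <= rho) by (unfold r; lra).
  assert (HC : Cmod (RtoC r) = r) by (rewrite Cmod_R, Rabs_pos_eq; lra).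
  specialize (Hv extremal extremal_coeff extremal_Omega extremal_expansion (RtoC r) r).
  assert (Dr : unit_disk (RtoC r)) by (unfold unit_disk; lra).
  specialize (Hv Dr HC (proj2 Hr1)).
  assert (Hd : Rbar_le (dist_to_set (extremal (RtoC 0)) (boundary (image_disk extremal)))
                 (1 / 2)).
  { unfold dist_to_set; apply Glb_Rbar_correct.
    exists (RtoC (- (1 / 2))); split; [apply extremal_boundary|].
    replace (RtoC (- (1 / 2)) - extremal (RtoC 0))%C with (RtoC (- (1 / 2)))
      by (unfold extremal; ring).
    rewrite Cmod_R, Rabs_Ropp, Rabs_pos_eq; lra. }
  pose proof (Rbar_le_trans _ _ _ Hv Hd) as H2.
  rewrite sum_from2_head in H2.
  - unfold extremal in H2.
    rewrite <- RtoC_mult, <- RtoC_mult, <- RtoC_plus in H2.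
    simpl in H2.
    rewrite !Cmod_R, !Rabs_pos_eq in H2 by nra.
    nra.
  - intros k; replace (S k + 2)%nat with (S (S (S k))) by lia.
    simpl extremal_coeff; rewrite Cmod_0; ring.
Qed.

Theorem theorem7p1 :
  bohr_valid ((sqrt 3 - 1) / 2) /\
  (forall rho : R, (sqrt 3 - 1) / 2 < rho -> ~ bohr_valid rho).
Proof. exact (conj bohr_valid_radius bohr_radius_sharp). Qed.
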